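(* Let $N>1$, let $\mathscr{P}=(A,B,C)$ be a linear time-invariant system with $A\in\mathbb{R}^{n\times n}$, $B\in\mathbb{R}^{n\times m}$, $C\in\mathbb{R}^{q\times n}$, let $K\in\mathbb{R}^{m\times q}$, and let $\mathscr{G}\in\mathcal{G}^N$ be a communication topology. Then the network $(\mathscr{P}^N,K,\mathscr{G})$ synchronizes if and only if $\sigma\{\tilde L_{\mathscr{G}}\}\subseteq \mathcal{S}_{\mathscr{P}}(K)$.
   Context: Graphs: $\mathcal{G}^N$ is the set of directed weighted graphs on nodes $\{1,\dots,N\}$ given by a weighted adjacency matrix $\Sigma=(\sigma_{i,j})\in\mathbb{R}^{N\times N}$ with $\sigma_{i,i}=0$ for all $i$ ($(i,j)$ is an edge iff $\sigma_{i,j}\neq0$). Weights may be negative and $\Sigma$ need not be symmetric. Network: the network $(\mathscr{P}^N,K,\mathscr{G})$ consists of $N$ copies of the system, $\dot x_i=Ax_i+Bu_i$, $y_i=Cx_i$, $x_i\in\mathbb{R}^n$, $u_i\in\mathbb{R}^m$, $y_i\in\mathbb{R}^q$, $i=1,\dots,N$, coupled by $u_i=K\sum_{j=1}^N\sigma_{i,j}(y_j-y_i)$. It is said to synchronize if $\lim_{t\to\infty}(x_i(t)-x_j(t))=0$ for all $i,j\in\{1,\dots,N\}$ and all initial conditions. Interconnection matrix: $L_{\mathscr{G}}\in\mathbb{R}^{N\times N}$ has entries $[L_{\mathscr{G}}]_{i,i}=\sum_{k=1}^N\sigma_{i,k}$ and $[L_{\mathscr{G}}]_{i,j}=-\sigma_{i,j}$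 for $i\ne j$. The reduced interconnection matrix is $\tilde L_{\mathscr{G}}=Q_NL_{\mathscr{G}}Q_N^T\in\mathbb{R}^{(N-1)\times(N-1)}$, where $Q_N\in\mathbb{R}^{(N-1)\times N}$ is any matrix with $Q_N\mathbf{1}_N=0$, $Q_N^TQ_N=I_N-\frac1N\mathbf{1}_N\mathbf{1}_N^T$, $Q_NQ_N^T=I_{N-1}$ ($\mathbf{1}_N$ is the all-ones column vector). The spectrum of $\tilde L_{\mathscr{G}}$ does not depend on the choice of $Q_N$: it is the spectrum of $L_{\mathscr{G}}$ with one instance of the eigenvalue $0$ removed. Notation: $\sigma\{M\}$ is the spectrum (multiset of eigenvalues) of a square matrix $M$. A square complex matrix is Hurwitz if all its eigenvalues have strictly negative real part. The synchronization region is $\mathcal{S}_{\mathscr{P}}(K)=\{s\in\mathbb{C}\mid A-sBKC\text{ is Hurwitz}\}$. *)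

(* Defs.v *)
From mathcomp Require Import all_boot all_order all_algebra.
From mathcomp Require Import complex.
From mathcomp Require Import all_classical all_reals all_analysis.

Set Implicit Arguments.
Unset Strict Implicit.
Unset Printing Implicit Defensive.

Import Order.TTheory GRing.Theory Num.Theory.
Import numFieldNormedType.Exports.

Local Open Scope classical_set_scope.
Local Open Scope ring_scope.

Section Spectrum.
Variable R : realType.

(* The eigenvalues of M listed with algebraic multiplicity, in an unspecified
   order: the sequence of roots of the characteristic polynomial. *)
Definition spectrum (n : nat) (M : 'M[R[i]]_n) : seq R[i] :=
  sval (closed_field_poly_normal (char_poly M)).

Lemma char_poly_spectrum (n : nat) (M : 'M[R[i]]_n) :
  char_poly M = \prod_(z <- spectrum M) ('X - z%:P).
Proof.
rewrite /spectrum; case: closed_field_poly_normal => r /= {1}->.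
by rewrite (monicP (char_poly_monic M)) scale1r.
Qed.

Lemma mem_spectrum (n : nat) (M : 'M[R[i]]_n) (s : R[i]) :
  (s \in spectrum M) = eigenvalue M s.
Proof.
by rewrite eigenvalue_root_char char_poly_spectrum root_prod_XsubC.
Qed.

Definition hurwitz (n : nat) (M : 'M[R[i]]_n) : Prop :=
  {in spectrum M, forall s, complex.Re s < 0}.

Definition complex_mx (m n : nat) (M : 'M[R]_(m, n)) : 'M[R[i]]_(m, n) :=
  map_mx (real_complex R) M.

Definition sync_region (n m q : nat) (A : 'M[R]_n) (B : 'M[R]_(n, m))
    (C : 'M[R]_(q, n)) (K : 'M[R]_(m, q)) : set R[i] :=
  [set s | hurwitz (complex_mx A - s *: complex_mx (B *m K *m C))].

End Spectrum.

Section Network.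
Variables (R : realType) (N : nat).

(* [Sigma i j] weights the influence of node j on node i, so row sums appear
   on the diagonal. *)
Definition interconnection_mx (Sigma : 'M[R]_N) : 'M[R]_N :=
  \matrix_(i, j) (if i == j then \sum_k Sigma i k else - Sigma i j).

Definition ones : 'cV[R]_N := const_mx 1.

Definition reduction_mx (Q : 'M[R]_(N.-1, N)) : Prop :=
  [/\ Q *m ones = 0,
      Q^T *m Q = 1%:M - N%:R^-1 *: (ones *m ones^T)
    & Q *m Q^T = 1%:M].

Definition reduced_interconnection_mx (Q : 'M[R]_(N.-1, N))
    (Sigma : 'M[R]_N) : 'M[R]_(N.-1) :=
  Q *m interconnection_mx Sigma *m Q^T.

Variables (n m q : nat).

Definition coupling (C : 'M[R]_(q, n)) (K : 'M[R]_(m, q)) (Sigma : 'M[R]_N)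
    (x : 'I_N -> 'cV[R]_n) (i : 'I_N) : 'cV[R]_m :=
  K *m \sum_j Sigma i j *: (C *m x j - C *m x i).

(* Classical solutions on [0, +oo[ : the values of x at negative times are
   irrelevant, hence continuity within [0, +oo[ and derivatives at t > 0. *)
Definition network_solution (A : 'M[R]_n) (B : 'M[R]_(n, m))
    (C : 'M[R]_(q, n)) (K : 'M[R]_(m, q)) (Sigma : 'M[R]_N)
    (x0 : 'I_N -> 'cV[R]_n) (x : 'I_N -> R -> 'cV[R]_n) : Prop :=
  forall i : 'I_N,
  [/\ x i 0 = x0 i,
      {within `[0, +oo[, continuous (x i)}
    & forall t : R, 0 < t ->
        is_derive t 1 (x i)
          (A *m x i t + B *m coupling C K Sigma (fun j => x j t) i)].

Definition synchronizes (A : 'M[R]_n) (B : 'M[R]_(n, m)) (C : 'M[R]_(q, n))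
    (K : 'M[R]_(m, q)) (Sigma : 'M[R]_N) : Prop :=
  forall (x0 : 'I_N -> 'cV[R]_n) (x : 'I_N -> R -> 'cV[R]_n),
    network_solution A B C K Sigma x0 x ->
    forall i j : 'I_N, x i t - x j t @[t --> +oo] --> (0 : 'cV[R]_n).

End Network.

(* Main.v *)
Require Import Defs.
From HB Require Import structures.
From mathcomp Require Import all_boot all_order all_algebra.
From mathcomp Require Import complex.
From mathcomp Require Import all_classical all_reals all_analysis.
From mathcomp Require Import ring lra.

(** Write the network state as the real matrix X whose j-th column is x_j, and
    put D = B K C.  The network equation is X' = A X - D X L^T, where L is the
    interconnection matrix.  Since L kills the all-ones vector, Q L = Lr Q with
    Lr the reduced matrix, so Z = X Q^T obeys the closed equation
    Z' = A Z - D Z Lr^T; moreover synchronization is exactly Z -> 0, because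
    the kernel of Q is spanned by the all-ones vector.

    Everything is read off the complex numbers y(p, r) = p Z r^T, for complex
    row vectors p and r (mode below).  They satisfy
      y(p, r)' = y(p A, r) - y(p D, r Lr),
    which, for any scalars s and lam, rearranges (mode_step) into
      y(p, r)' = lam y(p, r) + y(p (A - s D) - lam p, r) - y(p D, r Lr - s r).

    If the spectral condition holds, all the modes vanish at infinity.  By
    Cayley-Hamilton, a property of row vectors that passes from p M - z p to p
    for every eigenvalue z of M, and that holds for 0, holds for all row
    vectors (spectral_induction).  This induction is done on r with M = Lr, and
    then, for an eigenvalue s of Lr, on p with M = A - s D.  Its step is the
    scalar fact that y' = lam y + f with Re lam < 0 and f -> 0 forces y -> 0
    (stable_mode_vanishes, a Gronwall estimate for |y|^2).  Along
    the way no basis of generalized eigenvectors has to be chosen.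

    Conversely, let r be a left eigenvector of Lr for s and p a left
    eigenvector of A - s D for lam, with Re lam >= 0.  The last two terms of
    the equation above disappear, so |y(p, r)|^2 is nondecreasing along every
    solution and synchronization forces y(p, r) = 0 at time 0.  But the
    initial state delta_mx a b *m Q gives it the value p_a r_b, which is nonzero
    for suitable a and b.  A solution starting there is provided by the
    exponential series of the linear vector field (flow). *)

Set Implicit Arguments.
Unset Strict Implicit.
Unset Printing Implicit Defensive.
Import Order.TTheory GRing.Theory Num.Theory.
Import numFieldNormedType.Exports.

Local Open Scope classical_set_scope.
Local Open Scope ring_scope.

(** * Induction along the spectrum of a matrix *)

Section Spectral.
Variable R : realType.

(** Cayley-Hamilton says that the product of the M - z over the spectrum sends
    p to 0, where P holds; the factors are then peeled off one at a time. *)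
Lemma spectral_induction (n : nat) (M : 'M[R[i]]_n) (P : 'rV[R[i]]_n -> Prop) :
  P 0 ->
  (forall z p, z \in spectrum M -> P (p *m M - z *: p) -> P p) ->
  forall p, P p.
Proof.
(* Matrices only form a nontrivial ring, hence have polynomials evaluated at
   them, in positive dimension; in dimension 0 the only vector is 0. *)
case: n => [|n] in M P * => P0 Pstep p; first by rewrite (thinmx0 p).
suff peel : forall s : seq R[i], {subset s <= spectrum M} ->
    forall p, P (p *m horner_mx M (\prod_(z <- s) ('X - z%:P))) -> P p.
  apply: (peel (spectrum M)) => //.
  by rewrite -char_poly_spectrum Cayley_Hamilton mulmx0.
elim=> [|z s IHs] sub {}p; first by rewrite big_nil rmorph1 mulmx1.
rewrite big_cons rmorphM rmorphB /= horner_mx_X horner_mx_C => Ppzs.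
apply: (Pstep z); first by rewrite sub ?mem_head.
apply: IHs => [x xs|]; first by rewrite sub // in_cons xs orbT.
by move: Ppzs; rewrite mulmxA mulmxBr mul_mx_scalar.
Qed.

End Spectral.

(** * Scalar differential equations on the complex line *)

Section Scalar.
Variable R : realType.
Implicit Types (z : R -> R[i]) (rho h : R -> R).

Lemma cvg0Ml (c : R) (u : R -> R) :
  u t @[t --> +oo] --> 0 -> c * u t @[t --> +oo] --> 0.
Proof. by move=> u0; rewrite -[0](mulr0 c); exact: cvgMl_tmp. Qed.

(** Once h is below -a e/2, the function (rho - e/2) exp(-a t) is nonincreasing,
    so rho is at most e/2 plus a decaying exponential. *)
Lemma gronwall_vanish (a : R) rho rho' h :
  a < 0 -> (forall t : R, 0 <= rho t) ->
  (forall t : R, 0 < t -> is_derive t 1 rho (rho' t)) ->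
  (forall t : R, 0 < t -> rho' t <= a * rho t + h t) ->
  h t @[t --> +oo] --> 0 ->
  rho t @[t --> +oo] --> 0.
Proof.
move=> a0 rho0 drho rho_le h0.
apply/cvgrPdist_le => /= e e0.
have e20 : 0 < e / 2 by rewrite divr_gt0.
have ae0 : 0 < - a * (e / 2) by rewrite mulr_gt0 // oppr_gt0.
have [T T0 hT] : exists2 T, 0 < T & forall t, T <= t -> h t <= - a * (e / 2).
  move/cvgrPdist_le : h0 => /(_ _ ae0) [M [_ hM]].
  exists (Num.max 1 (M + 1)); first by rewrite lt_max ltr01.
  move=> t; rewrite ge_max => /andP[_ Mt].
  have := hM t; rewrite sub0r normrN => hMt.
  by apply: le_trans (ler_norm _) (hMt _); rewrite (lt_le_trans _ Mt)// ltrDl.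
pose G t := (rho t - e / 2) * expR (- a * t).
pose G' t := (rho' t - a * (rho t - e / 2)) * expR (- a * t).
have dG (t : R) : 0 < t -> is_derive t 1 G (G' t).
  move=> t0; have := drho _ t0 => ?; rewrite /G /G'.
  apply: is_derive_eq; rewrite /GRing.scale /=; ring.
have Gnincr (t : R) : T <= t -> G t <= G T.
  move=> Tt; apply: (@ler0_derive1_nincry _ G T) => //.
  - move=> x; rewrite in_itv/= andbT => Tx.
    by have := dG _ (lt_trans T0 Tx); case.
  - move=> x; rewrite in_itv/= andbT => Tx.
    have x0 := lt_trans T0 Tx.
    rewrite derive1E; have dGx := dG _ x0; rewrite derive_val.
    rewrite /G' mulr_le0_ge0 ?expR_ge0 //.
    have := rho_le _ x0; have := hT _ (ltW Tx); nra.
  - apply: derivable_within_continuous => x; rewrite in_itv/= andbT => Tx.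
    by have := dG _ (lt_le_trans T0 Tx); case.
have expa : expR (a * t) @[t --> +oo] --> (0 : R).
  have -> : (fun t => expR (a * t)) = (fun t => expR (- t)) \o (fun t => - a * t).
    by apply/funext => t /=; congr expR; ring.
  apply: (@cvg_comp _ _ _ _ _ _ (+oo : set_system R)); last exact: cvgr_expR.
  by apply: gt0_cvgMry; [rewrite oppr_gt0|exact: cvg_id].
have Gexpa : G T * expR (a * t) @[t --> +oo] --> (0 : R).
  exact: cvg0Ml.
move/cvgrPdist_le : Gexpa => /(_ _ e20) Gexp.
near=> t.
rewrite sub0r normrN ger0_norm //.
have Tt : T <= t by near: t; apply: nbhs_pinfty_ge; exact: num_real.
have Ge : G T * expR (a * t) <= e / 2.
  apply: le_trans (ler_norm _) _.
  by rewrite -normrN -[X in `|X|]sub0r; near: t.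
have rhoE : rho t - e / 2 = G t * expR (a * t).
  by rewrite /G -mulrA -expRD mulNr addNr expR0 mulr1.
have : G t * expR (a * t) <= G T * expR (a * t).
  by rewrite ler_wpM2r ?expR_ge0 ?Gnincr.
lra.
Unshelve. all: by end_near. Qed.

(** Limits and derivatives of complex functions of a real variable are taken on
    the real and imaginary parts, which keeps all the analysis real. *)
Definition vanishes z : Prop :=
  complex.Re (z t) @[t --> +oo] --> (0 : R) /\
  complex.Im (z t) @[t --> +oo] --> (0 : R).

Definition has_derivative z (t : R) (d : R[i]) : Prop :=
  is_derive t 1 (fun s => complex.Re (z s)) (complex.Re d) /\
  is_derive t 1 (fun s => complex.Im (z s)) (complex.Im d).

Lemma ReD (x y : R[i]) : complex.Re (x + y) = complex.Re x + complex.Re y.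
Proof. by case: x y => [? ?] []. Qed.
Lemma ImD (x y : R[i]) : complex.Im (x + y) = complex.Im x + complex.Im y.
Proof. by case: x y => [? ?] []. Qed.
Lemma ReM (x y : R[i]) : complex.Re (x * y) =
  complex.Re x * complex.Re y - complex.Im x * complex.Im y.
Proof. by case: x y => [? ?] []. Qed.
Lemma ImM (x y : R[i]) : complex.Im (x * y) =
  complex.Re x * complex.Im y + complex.Im x * complex.Re y.
Proof. by case: x y => [? ?] []. Qed.

Lemma vanishes0 : vanishes (fun=> 0).
Proof. by split; exact: cvg_cst. Qed.

Lemma vanishesD z1 z2 :
  vanishes z1 -> vanishes z2 -> vanishes (fun t => z1 t + z2 t).
Proof.
move=> [r1 i1] [r2 i2]; split; rewrite -[0](addr0 0).
  by under eq_fun do rewrite ReD; exact: cvgD.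
by under eq_fun do rewrite ImD; exact: cvgD.
Qed.

Lemma vanishesZ (c : R[i]) z : vanishes z -> vanishes (fun t => c * z t).
Proof.
move=> [r i]; split.
  under eq_fun do rewrite ReM.
  by rewrite -[0](subr0 0); apply: cvgB; exact: cvg0Ml.
under eq_fun do rewrite ImM.
by rewrite -[0](addr0 0); apply: cvgD; exact: cvg0Ml.
Qed.

Definition normsq (c : R[i]) : R := complex.Re c ^+ 2 + complex.Im c ^+ 2.

Lemma is_derive_normsq z t d : has_derivative z t d ->
  is_derive t 1 (fun s => normsq (z s))
    (2 * (complex.Re (z t) * complex.Re d + complex.Im (z t) * complex.Im d)).
Proof.
move=> [dr di]; rewrite /normsq.
apply: is_derive_eq; rewrite /GRing.scale /=; ring.
Qed.

Lemma vanishes_normsq z :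
  normsq (z t) @[t --> +oo] --> (0 : R) -> vanishes z.
Proof.
move=> z0.
have sq (u : R -> R) : (forall t, u t ^+ 2 <= normsq (z t)) ->
    u t @[t --> +oo] --> (0 : R).
  move=> uz; apply/cvgrPdist_le => e e0.
  have e2 : 0 < e ^+ 2 by rewrite exprn_gt0.
  move/cvgrPdist_le : z0 => /(_ _ e2); apply: filterS => t.
  rewrite !sub0r !normrN => zt.
  rewrite -(@ler_pXn2r _ 2) ?nnegrE ?(ltW e0)// real_normK ?num_real //.
  by apply: le_trans (uz t) (le_trans (ler_norm _) zt).
by split; apply: sq => t; rewrite /normsq ?lerDl ?lerDr sqr_ge0.
Qed.

Lemma normsq_vanishes z :
  vanishes z -> normsq (z t) @[t --> +oo] --> (0 : R).
Proof.
move=> [r i]; rewrite /normsq -[0](addr0 0) -[X in X + _](mulr0 0).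
by rewrite -[X in _ + X](mulr0 0); apply: cvgD; apply: cvgM.
Qed.

(** With a = Re lam, Young's inequality turns the derivative of |z|^2 into at
    most a |z|^2 + |f|^2 / (-a); the imaginary part of lam drops out. *)
Lemma stable_mode_vanishes (lam : R[i]) z f : complex.Re lam < 0 ->
  (forall t : R, 0 < t -> has_derivative z t (lam * z t + f t)) ->
  vanishes f -> vanishes z.
Proof.
move=> lam0 dz /normsq_vanishes f0; apply: vanishes_normsq.
pose a := complex.Re lam.
pose h t := (- a)^-1 * normsq (f t).
apply: (@gronwall_vanish a _ _ h lam0 _ (fun t t0 => is_derive_normsq (dz t t0))).
- by move=> t; rewrite addr_ge0 ?sqr_ge0.
- move=> t _; rewrite /h /normsq !(ReD, ImD, ReM, ImM) -/a.
  set u := complex.Re (z t); set v := complex.Im (z t).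
  set r := complex.Re (f t); set s := complex.Im (f t).
  have k0 : 0 < - a by rewrite oppr_gt0.
  have young (x y : R) : 2 * (x * y) <= - a * x ^+ 2 + (- a)^-1 * y ^+ 2.
    rewrite -subr_ge0.
    have -> : - a * x ^+ 2 + (- a)^-1 * y ^+ 2 - 2 * (x * y) =
        (- a)^-1 * (- a * x - y) ^+ 2.
      by field; rewrite -oppr_eq0 lt0r_neq0.
    by rewrite mulr_ge0 ?sqr_ge0 ?invr_ge0 ?ltW.
  have := young u r; have := young v s; lra.
- exact: cvg0Ml.
Qed.

(** Here |z|^2 is nondecreasing, so it cannot tend to 0 unless it is 0 at the
    origin. *)
Lemma unstable_mode_vanishes (lam : R[i]) z : 0 <= complex.Re lam ->
  {within `[0, +oo[, continuous (fun t => complex.Re (z t))} ->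
  {within `[0, +oo[, continuous (fun t => complex.Im (z t))} ->
  (forall t : R, 0 < t -> has_derivative z t (lam * z t)) ->
  vanishes z -> z 0 = 0.
Proof.
move=> lam0 cr ci dz /normsq_vanishes z0.
have dn (t : R) : 0 < t -> is_derive t 1 (fun s => normsq (z s))
    (2 * complex.Re lam * normsq (z t)).
  move=> t0; have := is_derive_normsq (dz t t0) => ?.
  by apply: is_derive_eq; rewrite /normsq !(ReM, ImM); ring.
have ndecr (t : R) : 0 <= t -> normsq (z 0) <= normsq (z t).
  move=> t0; apply: (@ger0_derive1_ndecry _ (fun t => normsq (z t)) 0) => //.
  - by move=> x; rewrite in_itv/= andbT => /dn[].
  - move=> x; rewrite in_itv/= andbT => /dn dnx.
    by rewrite derive1E derive_val !mulr_ge0 ?addr_ge0 ?sqr_ge0.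
  - move=> x; apply: cvgD; apply: cvgM.
    + exact: cr.
    + exact: cr.
    + exact: ci.
    + exact: ci.
have : normsq (z 0) <= 0.
  rewrite leNgt; apply/negP => n0.
  move/cvgrPdist_lt : z0 => /(_ _ n0) [M [_ hM]].
  have := hM (Num.max 0 (M + 1)).
  rewrite lt_max [M < M + 1]ltrDl ltr01 orbT => /(_ isT).
  rewrite sub0r normrN => /(le_lt_trans (ler_norm _)).
  by rewrite ltNge ndecr // le_max lexx.
rewrite /normsq; case: (z 0) => x y /=.
move=> le0; have := sqr_ge0 x; have := sqr_ge0 y => y0 x0.
have /eqP : x ^+ 2 = 0 by lra.
have /eqP : y ^+ 2 = 0 by lra.
by rewrite !sqrf_eq0 => /eqP -> /eqP ->.
Qed.

End Scalar.

(** * Linear functionals of matrix-valued functions *)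

Section Functional.
Variables (R : realType) (m n : nat).
Implicit Types (phi : 'M[R]_(m, n) -> R) (X : R -> 'M[R]_(m, n)).

(** Being determined by its values on the elementary matrices, a functional is
    a finite sum of entries; limits and derivatives pass through it. *)
Lemma functionalE phi : scalar phi ->
  forall Y, phi Y = \sum_i \sum_j phi (delta_mx i j) * Y i j.
Proof.
move=> philin Y.
pose f : {scalar 'M[R]_(m, n)} :=
  HB.pack phi (GRing.isLinear.Build R _ _ _ phi philin).
rewrite {1}[Y]matrix_sum_delta -[phi]/(f : _ -> _) linear_sum.
apply: eq_bigr => i _; rewrite linear_sum; apply: eq_bigr => j _.
by rewrite linearZ /= mulrC.
Qed.

Lemma functional_cvg phi (T : Type) (F : set_system T) (X : T -> 'M[R]_(m, n))
    (Y : 'M[R]_(m, n)) : Filter F -> scalar phi ->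
  (forall i j, X t i j @[t --> F] --> Y i j) ->
  phi (X t) @[t --> F] --> phi Y.
Proof.
move=> FF philin XY; rewrite (functionalE philin).
under eq_fun do rewrite (functionalE philin).
apply: cvg_big => [|i _]; first exact: add_continuous.
apply: cvg_big => [|j _]; [exact: add_continuous|exact: cvgMl_tmp].
Qed.

Lemma functional_is_derive phi X (X' : 'M[R]_(m, n)) (t : R) : scalar phi ->
  (forall i j, is_derive t 1 (fun s => X s i j) (X' i j)) ->
  is_derive t 1 (fun s => phi (X s)) (phi X').
Proof.
move=> philin dX; rewrite (functionalE philin).
under eq_fun do rewrite (functionalE philin).
have -> : (fun s => \sum_i \sum_j phi (delta_mx i j) * X s i j) =
    \sum_i \sum_j (phi (delta_mx i j) \*: (fun s => X s i j)).
  apply/funext => s; rewrite fct_sumE; apply: eq_bigr => i _.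
  by rewrite fct_sumE.
by apply: is_derive_sum => i; apply: is_derive_sum => j.
Qed.

End Functional.

(** * Global solutions of linear matrix equations *)

Section LinearODE.
Variables (R : realType) (m n : nat).
Variable T : {linear 'M[R]_(m, n) -> 'M[R]_(m, n)}.
Implicit Types (Y : 'M[R]_(m, n)).

Lemma entry_le_norm Y i j : `|Y i j| <= `|Y|.
Proof. by rewrite [leRHS]/Num.Def.normr/= mx_normrE (le_bigmax _ _ (i, j)). Qed.

Definition op_bound : R := \sum_i \sum_j `|T (delta_mx i j)|.

Lemma op_bound_ge0 : 0 <= op_bound.
Proof. by apply: sumr_ge0 => i _; apply: sumr_ge0. Qed.

(** A crude operator norm: it only has to make the exponential series of T
    converge. *)
Lemma op_boundP Y : `|T Y| <= op_bound * `|Y|.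
Proof.
rewrite {1}[Y]matrix_sum_delta linear_sum mulr_suml.
apply: le_trans (ler_norm_sum _ _ _) _; apply: ler_sum => i _.
rewrite linear_sum mulr_suml.
apply: le_trans (ler_norm_sum _ _ _) _; apply: ler_sum => j _.
by rewrite linearZ normrZ mulrC ler_wpM2l ?entry_le_norm.
Qed.

Lemma iter_op_bound k Y : `|iter k T Y| <= op_bound ^+ k * `|Y|.
Proof.
elim: k => [|k IHk]; first by rewrite mul1r.
rewrite iterS exprS -mulrA; apply: le_trans (op_boundP _) _.
by rewrite ler_wpM2l ?op_bound_ge0.
Qed.

(** The coefficients of the entry (i, j) of the power series exp(t T) Y. *)
Definition exp_coef Y i j (k : nat) : R := k`!%:R^-1 * iter k T Y i j.

(** Formal differentiation of the exponential series only replaces Y by T Y, so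
    the termwise derivative theorem needs no convergence fact but
    is_cvg_exp_coef. *)
Lemma exp_coef_diffs Y i j :
  pseries_diffs (exp_coef Y i j) = exp_coef (T Y) i j.
Proof.
apply/funext => k; rewrite /pseries_diffs /exp_coef factS natrM invfM.
by rewrite mulrA mulrA mulfV ?pnatr_eq0 // mul1r iterSr.
Qed.

Lemma is_cvg_exp_coef Y i j (t : R) : cvgn (pseries (exp_coef Y i j) t).
Proof.
apply: normed_cvg; rewrite /normed_series_of /=.
apply: (@series_le_cvg _ _ (`|Y| *: exp_coeff (op_bound * `|t|))).
- by move=> k.
- move=> k; rewrite /= mulr_ge0 // exp_coeff_ge0 // mulr_ge0 //.
  exact: op_bound_ge0.
- move=> k.
  rewrite -[leRHS]/(`|Y| * ((op_bound * `|t|) ^+ k / k`!%:R)) /exp_coef.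
  rewrite /= !normrM exprMn normfV normrX [`|k`!%:R|]ger0_norm ?ler0n //.
  rewrite [leRHS](_ : _ =
    k`!%:R^-1 * (op_bound ^+ k * `|Y|) * `|t| ^+ k); last by ring.
  rewrite ler_wpM2r ?exprn_ge0 // ler_wpM2l ?invr_ge0 ?ler0n //.
  exact: le_trans (entry_le_norm _ _ _) (iter_op_bound _ _).
- exact/is_cvg_seriesZ/is_cvg_series_exp_coeff.
Qed.

Definition flow Y (t : R) : 'M[R]_(m, n) :=
  \matrix_(i, j) limn (pseries (exp_coef Y i j) t).

(** T commutes with the partial sums of the series, and passes to the limit
    because each entry of T is a functional. *)
Lemma flow_op Y t : flow (T Y) t = T (flow Y t).
Proof.
apply/matrixP => i j.
pose S k := \sum_(0 <= l < k) (l`!%:R^-1 * t ^+ l) *: iter l T Y.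
have SE k i' j' Z : (\sum_(0 <= l < k) (l`!%:R^-1 * t ^+ l) *: iter l T Z) i' j' =
    pseries (exp_coef Z i' j') t k.
  rewrite summxE /pseries /series /=; apply: eq_bigr => l _.
  by rewrite mxE /exp_coef mulrAC.
rewrite mxE; apply/cvg_lim => //.
have TS : (fun k => T (S k) i j) @ \oo --> T (flow Y t) i j.
  apply: (functional_cvg (phi := fun Z => T Z i j)).
    by move=> a U V; rewrite linearP !mxE.
  move=> i' j'; rewrite mxE; under eq_fun do rewrite SE.
  exact: is_cvg_exp_coef.
have -> // : pseries (exp_coef (T Y) i j) t = (fun k => T (S k) i j).
apply/funext => k; rewrite -SE linear_sum !summxE; apply: eq_bigr => l _.
by rewrite linearZ -iterS iterSr.
Qed.

Lemma flow0 Y : flow Y 0 = Y.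
Proof.
apply/matrixP => i j; rewrite mxE; apply: lim_near_cst => //.
exists 1%N => // k /= k0; rewrite /pseries /series /=.
rewrite big_ltn // big_add1 /= big1 ?addr0; last first.
  by move=> l _; rewrite expr0n mulr0.
by rewrite /exp_coef expr0 mulr1 fact0 invr1 mul1r.
Qed.

Lemma is_derive_flow Y (t : R) i j :
  is_derive t 1 (fun s => flow Y s i j) (T (flow Y t) i j).
Proof.
rewrite -flow_op mxE -exp_coef_diffs.
have -> : (fun s => flow Y s i j) = (fun s => limn (pseries (exp_coef Y i j) s)).
  by apply/funext => s; rewrite mxE.
apply: (@pseries_snd_diffs _ _ (`|t| + 1)).
- exact: is_cvg_exp_coef.
- rewrite exp_coef_diffs; exact: is_cvg_exp_coef.
- rewrite !exp_coef_diffs; exact: is_cvg_exp_coef.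
- by rewrite (lt_le_trans _ (ler_norm _)) // ltrDl.
Qed.

End LinearODE.

(** * Observing a real matrix through two complex vectors *)

(** The identity behind mode_step: the terms in s and lam cancel by
    bilinearity in p and r. *)
Lemma bilinear_step (F : comNzRingType) (n k : nat) (A' D' : 'M[F]_n)
    (L' : 'M[F]_k) (Z : 'M[F]_(n, k)) (p : 'rV[F]_n) (r : 'rV[F]_k) (s lam : F) :
  (p *m A' *m Z *m r^T) 0 0 - (p *m D' *m Z *m (r *m L')^T) 0 0 =
  lam * (p *m Z *m r^T) 0 0 +
  (((p *m (A' - s *: D') - lam *: p) *m Z *m r^T) 0 0 +
   -1 * (p *m D' *m Z *m (r *m L' - s *: r)^T) 0 0).
Proof.
rewrite mulmxBr -scalemxAr !linearB /= !mulmxBl !linearZ /=.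
rewrite -!scalemxAl !mxE; ring.
Qed.

Lemma bilinear_delta (F : comNzRingType) (n k : nat) (p : 'rV[F]_n)
    (r : 'rV[F]_k) (a : 'I_n) (b : 'I_k) :
  (p *m delta_mx a b *m r^T) 0 0 = p 0 a * r 0 b.
Proof.
rewrite -(mul_delta_mx (0 : 'I_1)) mulmxA -colE -mulmxA -rowE.
by rewrite mxE big_ord1 !mxE.
Qed.

Section Observable.
Variables (R : realType) (n N : nat).
Implicit Types (p : 'rV[R[i]]_n) (w : 'cV[R[i]]_N) (X : 'M[R]_(n, N)).

Definition observable p w X : R[i] := (p *m complex_mx X *m w) 0 0.

Lemma observable_linear p w (a : R) X Y :
  observable p w (a *: X + Y) = (real_complex R a) * observable p w X +
  observable p w Y.
Proof.
rewrite /observable /complex_mx map_mxD map_mxZ mulmxDr mulmxDl -scalemxAr.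
by rewrite -scalemxAl !mxE.
Qed.

Lemma Re_observable_linear p w : scalar (fun X => complex.Re (observable p w X)).
Proof.
move=> a X Y; rewrite observable_linear.
case: (observable p w X) (observable p w Y) => ? ? [] ? ? /=.
by rewrite mul0r subr0.
Qed.

Lemma Im_observable_linear p w : scalar (fun X => complex.Im (observable p w X)).
Proof.
move=> a X Y; rewrite observable_linear.
case: (observable p w X) (observable p w Y) => ? ? [] ? ? /=.
by rewrite mul0r addr0.
Qed.

Lemma vanishes_observable p w (X : R -> 'M[R]_(n, N)) :
  (forall i j, X t i j @[t --> +oo] --> (0 : R)) ->
  vanishes (fun t => observable p w (X t)).
Proof.
move=> X0.
have obs0 : observable p w 0 = 0.
  by rewrite /observable /complex_mx map_mx0 mulmx0 mul0mx mxE.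
have {}X0 i j : X t i j @[t --> +oo] --> (0 : 'M[R]_(n, N)) i j.
  by rewrite mxE; exact: X0.
split.
  by have := functional_cvg _ (Re_observable_linear p w) X0; rewrite obs0; apply.
by have := functional_cvg _ (Im_observable_linear p w) X0; rewrite obs0; apply.
Qed.

End Observable.

(** * The network *)

Section Network.
Variables (R : realType) (N n m q : nat).
Variables (A : 'M[R]_n) (B : 'M[R]_(n, m)) (C : 'M[R]_(q, n)).
Variables (K : 'M[R]_(m, q)) (Sigma : 'M[R]_N) (Q : 'M[R]_(N.-1, N)).
Hypothesis Sigma_diag : forall i : 'I_N, Sigma i i = 0.
Hypothesis Q_red : reduction_mx Q.

Let L := interconnection_mx Sigma.
Let Lr := reduced_interconnection_mx Q Sigma.
Let D := B *m K *m C.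

Definition stack (x : 'I_N -> 'cV[R]_n) : 'M[R]_(n, N) :=
  \matrix_(a, j) x j a 0.

Definition network_field (X : 'M[R]_(n, N)) : 'M[R]_(n, N) :=
  A *m X - D *m X *m L^T.

Lemma network_field_linear : linear network_field.
Proof.
move=> a X Y; rewrite /network_field !mulmxDr mulmxDl -!scalemxAr -scalemxAl.
by rewrite scalerBr opprD addrACA.
Qed.

HB.instance Definition _ :=
  GRing.isLinear.Build R _ _ _ network_field network_field_linear.

Lemma interconnection_ones : L *m ones R N = 0.
Proof.
apply/matrixP => i k; rewrite !mxE (bigD1 i) //= !mxE eqxx mulr1.
rewrite (bigD1 i) //= Sigma_diag add0r -big_split /= big1 // => j ji.
by rewrite !mxE eq_sym (negPf ji) mulr1 subrr.
Qed.

(** The diagonal of L is a full row sum while the sum on the left has no term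
    for j = i; the two agree because Sigma has zero diagonal. *)
Lemma coupling_interconnection (x : 'I_N -> 'cV[R]_n) i :
  \sum_j Sigma i j *: (x j - x i) = - \sum_j L i j *: x j.
Proof.
have rowsum : \sum_k Sigma i k = \sum_(k | k != i) Sigma i k.
  by rewrite (bigD1 i) //= Sigma_diag add0r.
rewrite (bigD1 i) //= subrr scaler0 add0r [in RHS](bigD1 i) //= mxE eqxx.
rewrite rowsum opprD scaler_suml -!sumrN -big_split /=.
apply: eq_bigr => j ji; rewrite mxE eq_sym (negPf ji).
by rewrite scaleNr opprK scalerBr addrC.
Qed.

Lemma network_field_col (x : 'I_N -> 'cV[R]_n) i :
  A *m x i + B *m coupling C K Sigma x i = col i (network_field (stack x)).
Proof.
have colx j : col j (stack x) = x j by apply/matrixP => a b; rewrite !mxE ord1.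
have -> : coupling C K Sigma x i = K *m C *m \sum_j Sigma i j *: (x j - x i).
  rewrite /coupling -mulmxA; congr mulmx; rewrite mulmx_sumr.
  apply: eq_bigr => j _.
  by rewrite -mulmxBr scalemxAr.
have sumE : \sum_j L i j *: x j = stack x *m L^T *m delta_mx i 0.
  apply/matrixP => a b; rewrite -colE !mxE summxE ord1.
  by apply: eq_bigr => j _; rewrite !mxE mulrC.
rewrite coupling_interconnection sumE -{1}(colx i) /network_field linearB /=.
by rewrite !colE !mulmxN !mulmxA -/D.
Qed.

(** Q^T Q is the identity up to a multiple of ones ones^T, which L kills. *)
Lemma reduction_interconnection : Q *m L = Lr *m Q.
Proof.
have [_ QTQ _] := Q_red.
rewrite /Lr /reduced_interconnection_mx -/L -!mulmxA QTQ mulmxBr mulmx1.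
by rewrite -scalemxAr mulmxA interconnection_ones mul0mx scaler0 subr0.
Qed.

(** For eigenvectors p and r, this is the coordinate of the disagreement
    X *m Q^T along an eigendirection of the reduced dynamics. *)
Definition mode (p : 'rV[R[i]]_n) (r : 'rV[R[i]]_N.-1) (X : 'M[R]_(n, N)) :
    R[i] :=
  observable p r^T (X *m Q^T).

Lemma modeE p r X :
  mode p r X = observable p (complex_mx Q^T *m r^T) X.
Proof. by rewrite /mode /observable /complex_mx map_mxM !mulmxA. Qed.

Lemma Re_mode_linear p r : scalar (fun X => complex.Re (mode p r X)).
Proof. by move=> a X Y; rewrite !modeE; exact: Re_observable_linear. Qed.

Lemma Im_mode_linear p r : scalar (fun X => complex.Im (mode p r X)).
Proof. by move=> a X Y; rewrite !modeE; exact: Im_observable_linear. Qed.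

Lemma mode_field p r X :
  mode p r (network_field X) =
  mode (p *m complex_mx A) r X - mode (p *m complex_mx D) (r *m complex_mx Lr) X.
Proof.
have fieldQ : network_field X *m Q^T = A *m (X *m Q^T) - D *m (X *m Q^T) *m Lr^T.
  rewrite /network_field mulmxBl -!mulmxA; congr (_ - mulmx _ (mulmx _ _)).
  by rewrite -!trmx_mul reduction_interconnection.
rewrite /mode /observable fieldQ; move: (X *m Q^T) (D) (Lr) => Z D' L'.
rewrite /complex_mx map_mxB !map_mxM mulmxBr mulmxBl trmx_mul map_trmx !mulmxA.
by rewrite mxE [in X in _ + X]mxE.
Qed.

Lemma mode0l r X : mode 0 r X = 0.
Proof. by rewrite /mode /observable !mul0mx mxE. Qed.

Lemma mode0r p X : mode p 0 X = 0.
Proof. by rewrite /mode /observable trmx0 mulmx0 mxE. Qed.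

(** For r an eigenvector of Lr for s and p one of A - s D for lam, only the first
    term remains; in general the two others are lower in a generalized
    eigenspace filtration, which is what the spectral induction exploits. *)
Lemma mode_step p r X (s lam : R[i]) :
  mode p r (network_field X) = lam * mode p r X +
    (mode (p *m (complex_mx A - s *: complex_mx D) - lam *: p) r X +
     -1 * mode (p *m complex_mx D) (r *m complex_mx Lr - s *: r) X).
Proof.
rewrite mode_field /mode /observable.
exact: bilinear_step.
Qed.

Section Solution.
Variables (x0 : 'I_N -> 'cV[R]_n) (x : 'I_N -> R -> 'cV[R]_n).
Hypothesis xsol : network_solution A B C K Sigma x0 x.

Let X t := stack (fun j => x j t).

Lemma mode_derivative p r (t : R) : 0 < t ->
  has_derivative (fun s => mode p r (X s)) t (mode p r (network_field (X t))).
Proof.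
move=> t0.
have dX i j : is_derive t 1 (fun s => X s i j) (network_field (X t) i j).
  have [_ _ /(_ t t0)] := xsol j; rewrite network_field_col => -[dx dxE].
  have -> : (fun s => X s i j) = (fun s => x j s i 0).
    by apply/funext => s; rewrite /X mxE.
  apply: DeriveDef; first by move/derivable_mxP : dx => /(_ i 0).
  by move/matrixP : dxE => /(_ i 0); rewrite (derive_mx dx) !mxE.
split; first exact: (functional_is_derive (Re_mode_linear p r)).
exact: (functional_is_derive (Im_mode_linear p r)).
Qed.

Lemma functional_solution_continuous (phi : 'M[R]_(n, N) -> R) : scalar phi ->
  {within `[0, +oo[, continuous (fun t => phi (X t))}.
Proof.
move=> philin t; apply: functional_cvg => // i j.
have [_ cx _] := xsol j.
have XE s : X s i j = x j s i 0 by rewrite /X mxE.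
under eq_cvg do rewrite XE.
rewrite XE.
apply: (@cvg_comp _ _ _ (x j) (fun Y : 'cV[R]_n => Y i 0) _ (nbhs (x j t))).
  exact: cx.
exact: coord_continuous.
Qed.

(** Two nested spectral inductions: the outer hypothesis handles all p at once,
    since the step on r produces a mode with p D in place of p. *)
Lemma modes_vanish :
  [set` spectrum (complex_mx Lr)] `<=` sync_region A B C K ->
  forall r p, vanishes (fun t => mode p r (X t)).
Proof.
move=> region.
apply: (@spectral_induction _ _ (complex_mx Lr)).
  move=> p; rewrite (_ : (fun _ => _) = fun=> 0); first exact: vanishes0.
  by apply/funext => t; rewrite mode0r.
move=> s r sL IHr.
apply: (@spectral_induction _ _ (complex_mx A - s *: complex_mx D)).
  rewrite (_ : (fun _ => _) = fun=> 0); first exact: vanishes0.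
  by apply/funext => t; rewrite mode0l.
move=> lam p lamM IHp.
pose f t := mode (p *m (complex_mx A - s *: complex_mx D) - lam *: p) r (X t) +
   -1 * mode (p *m complex_mx D) (r *m complex_mx Lr - s *: r) (X t).
apply: (@stable_mode_vanishes _ lam _ f); first exact: (region s).
  by move=> t t0; rewrite /f -mode_step; exact: mode_derivative.
by apply: vanishesD => //; exact: vanishesZ.
Qed.

(** e_k - e_l is orthogonal to the all-ones vector, hence fixed by Q^T Q, so
    a difference of node states is a function of X Q^T. *)
Lemma entry_mode t (k l : 'I_N) (a : 'I_n) :
  (x k t - x l t) a 0 = complex.Re (mode (complex_mx (delta_mx 0 a))
    (complex_mx (Q *m (delta_mx k 0 - delta_mx l 0))^T) (X t)).
Proof.
have [_ QTQ _] := Q_red.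
rewrite /X /mode /observable /complex_mx -map_trmx trmxK -!map_mxM [in RHS]mxE /=.
rewrite -!mulmxA [Q^T *m _]mulmxA QTQ mulmxBl mul1mx -scalemxAl -mulmxA.
have -> : (ones R N)^T *m (delta_mx k 0 - delta_mx l 0) = (0 : 'M[R]_(1, 1)).
  rewrite mulmxBr -!colE; apply/matrixP => ? ?.
  by rewrite !mxE subrr.
rewrite mulmx0 scaler0 subr0 -rowE mxE mulmxBr -!colE !mxE //.
Qed.

Lemma modes_vanish_sync : (forall r p, vanishes (fun t => mode p r (X t))) ->
  forall k l, x k t - x l t @[t --> +oo] --> (0 : 'cV[R]_n).
Proof.
move=> vanish k l; apply/cvgrPdist_le => /= e e0.
near=> t.
rewrite /Num.Def.normr/= mx_normrE (bigmax_le _ (ltW e0))//= => ab _.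
move: ab; near: t; apply: filter_forall => -[a b] /=.
have [+ _] := vanish (complex_mx (Q *m (delta_mx k 0 - delta_mx l 0))^T)
  (complex_mx (delta_mx 0 a)).
move/cvgrPdist_le => /(_ _ e0); apply: filterS => t.
by rewrite -entry_mode ord1 !mxE.
Unshelve. all: by end_near. Qed.

(** As Q kills the all-ones vector, X may be replaced by its difference with
    the state of a reference node k, whose entries tend to 0. *)
Lemma sync_modes_vanish (k : 'I_N) :
  (forall l, x l t - x k t @[t --> +oo] --> (0 : 'cV[R]_n)) ->
  forall p r, vanishes (fun t => mode p r (X t)).
Proof.
move=> sync p r; apply: vanishes_observable => a b.
pose Y t : 'M[R]_(n, N) := X t - x k t *m (ones R N)^T.
have XY t : X t *m Q^T = Y t *m Q^T.
  have [Q1 _ _] := Q_red.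
  by rewrite mulmxBl -mulmxA -trmx_mul Q1 trmx0 mulmx0 subr0.
under eq_fun do rewrite XY.
have := @functional_cvg R n N (fun Z => (Z *m Q^T) a b) _ +oo Y 0.
rewrite mul0mx mxE; apply.
  by move=> c U V; rewrite mulmxDl -scalemxAl !mxE.
move=> i j; rewrite mxE.
have -> : (fun t => Y t i j) = (fun t => (x j t - x k t) i 0).
  by apply/funext => t; rewrite /Y /X !mxE big_ord1 !mxE mulr1.
have -> : 0 = (0 : 'cV[R]_n) i 0 by rewrite mxE.
apply: (@cvg_comp _ _ _ (fun t => x j t - x k t) (fun Z : 'cV[R]_n => Z i 0)
  _ (nbhs (0 : 'cV[R]_n))); first exact: sync.
exact: coord_continuous.
Qed.

End Solution.

(** The series solves the equation on the whole real line, so it is in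
    particular continuous at the origin of [0, +oo[. *)
Lemma flow_solution (X0 : 'M[R]_(n, N)) :
  network_solution A B C K Sigma (fun j => col j X0)
    (fun j t => col j (flow network_field X0 t)).
Proof.
have stackE t : stack (fun j => col j (flow network_field X0 t)) =
    flow network_field X0 t by apply/matrixP => i j; rewrite !mxE.
move=> j.
have dx (t : R) : is_derive t 1 (fun s => col j (flow network_field X0 s))
    (col j (network_field (flow network_field X0 t))).
  have dF i := is_derive_flow network_field X0 t i j.
  have colE' i b : (fun s => col j (flow network_field X0 s) i b) =
    (fun s => flow network_field X0 s i j) by apply/funext => s; rewrite mxE.
  have dcol : derivable (fun s => col j (flow network_field X0 s)) t 1.
    by apply/derivable_mxP => i b; rewrite colE'; case: (dF i).
  apply: DeriveDef => //; rewrite derive_mx //.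
  apply/matrixP => i b; rewrite [LHS]mxE [RHS]mxE colE'.
  by have dFi := dF i; rewrite derive_val.
split.
- by rewrite flow0.
- apply: continuous_subspaceT => t.
  apply: differentiable_continuous; apply/derivable1_diffP.
  by case: (dx t).
- by move=> t _; rewrite network_field_col stackE.
Qed.

(** An unstable pair of left eigenvectors gives a mode that cannot vanish,
    unless it vanishes initially; the initial state is chosen so that X0 Q^T is
    an elementary matrix at nonzero entries of p and r. *)
Lemma sync_spectrum (k0 : 'I_N) : synchronizes A B C K Sigma ->
  [set` spectrum (complex_mx Lr)] `<=` sync_region A B C K.
Proof.
move=> sync s /=; rewrite mem_spectrum => /eigenvalueP[r rL r0] lam.
rewrite mem_spectrum -/D => /eigenvalueP[p pM p0].
rewrite ltNge; apply/negP => lam0.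
have /rV0Pn[a pa] := p0; have /rV0Pn[b rb] := r0.
pose X0 : 'M[R]_(n, N) := delta_mx a b *m Q.
have xsol := flow_solution X0.
pose y t := mode p r (stack (fun j => col j (flow network_field X0 t))).
suff y0 : y 0 = 0.
  have X0Q : X0 *m Q^T = delta_mx a b.
    by have [_ _ QQT] := Q_red; rewrite -mulmxA QQT mulmx1.
  have stackE : stack (fun j => col j (flow network_field X0 0)) = X0.
    by rewrite flow0; apply/matrixP => i j; rewrite !mxE.
  move/eqP: y0; rewrite /y /mode /observable stackE X0Q.
  rewrite /complex_mx map_delta_mx bilinear_delta mulf_eq0.
  by rewrite (negPf pa) (negPf rb).
apply: (@unstable_mode_vanishes R lam y lam0).
- exact: (functional_solution_continuous xsol (Re_mode_linear p r)).
- exact: (functional_solution_continuous xsol (Im_mode_linear p r)).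
- move=> t t0.
  have -> : lam * y t =
      mode p r (network_field (stack (fun j => col j (flow network_field X0 t)))).
    rewrite (mode_step _ _ _ s lam) pM rL !subrr mode0l mode0r.
    by rewrite mulr0 !addr0.
  exact: (mode_derivative xsol).
- exact: (sync_modes_vanish (fun l => sync _ _ xsol l k0)).
Qed.

End Network.

Theorem theorem1 (R : realType) (N n m q : nat) (N_gt1 : (1 < N)%N)
    (A : 'M[R]_n) (B : 'M[R]_(n, m)) (C : 'M[R]_(q, n)) (K : 'M[R]_(m, q))
    (Sigma : 'M[R]_N) (Sigma_diag : forall i : 'I_N, Sigma i i = 0)
    (Q : 'M[R]_(N.-1, N)) (Q_red : reduction_mx Q) :
  synchronizes A B C K Sigma <->
  [set` spectrum (complex_mx (reduced_interconnection_mx Q Sigma))]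
    `<=` sync_region A B C K.
Proof.
split; first exact: (sync_spectrum Sigma_diag Q_red (Ordinal (ltnW N_gt1))).
move=> region x0 x xsol; apply: (modes_vanish_sync Q_red).
exact: (modes_vanish Sigma_diag Q_red xsol).
Qed.
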